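(* Let $\Gamma$ be a countable amenable group and let $\Gamma\curvearrowright Y$ and $\Gamma\curvearrowright Z$ be two dynamical systems. Let $\Gamma$ act on $Y\times Z$ diagonally and let $\pi\colon Y\times Z\to Y$ be the projection map. Then $$\operatorname{mdim}(Y\times Z|Y)=\operatorname{mdim}(Z).$$
   Context: $\Gamma$ is a countable amenable group and $\mathcal F(\Gamma)$ is the set of nonempty finite subsets of $\Gamma$. For $K\in\mathcal F(\Gamma)$ and $\delta>0$, $\mathcal B(K,\delta)$ is the set of $F\in\mathcal F(\Gamma)$ with $|\{t\in F: Kt\subseteq F\}|\ge(1-\delta)|F|$. For a real-valued $\varphi$ on $\mathcal F(\Gamma)$, $\lim_F\varphi(F)=c$ means: for every $\varepsilon>0$ there are $K\in\mathcal F(\Gamma)$, $\delta>0$ with $|\varphi(F)-c|<\varepsilon$ for all $F\in\mathcal B(K,\delta)$. A dynamical system $\Gamma\curvearrowright X$ is a (nonempty) compact metrizable space $X$ with a continuous action of $\Gamma$. A factor map $\pi\colon X\to Y$ is a continuous $\Gamma$-equivariant surjection. For a finite open cover $\mathcal U$ of $X$, $\operatorname{ord}(\mathcal U)=\max_{x\in X}\sum_{U\in\mathcal U}1_U(x)-1$. For families of sets, $\mathcal U\vee\mathcal V=\{U\cap V:U\in\mathcal U,V\in\mathcal V\}$, and $\mathcal U$ refines $\mathcal V$ if every element of $\mathcal U$ is contained in some element of $\mathcal V$. For $F\in\mathcal F(\Gamma)$, $\mathcal U^F=\bigvee_{s\in F}s^{-1}\mathcal U$. For a factor map $\pi\colon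 X\to Y$, $\mathcal D(\mathcal U|Y)$ is the minimum of $\operatorname{ord}(\mathcal W)$ over all finite open covers $\mathcal W$ of $X$ such that $\{\pi^{-1}(y)\}_{y\in Y}\vee\mathcal W$ refines $\mathcal U$. The limit $\lim_F\mathcal D(\mathcal U^F|Y)/|F|$ exists, and the conditional mean dimension (relative to $\pi$) is $$\operatorname{mdim}(X|Y)=\sup_{\mathcal U}\lim_F\frac{\mathcal D(\mathcal U^F|Y)}{|F|}\in[0,\infty],$$ with $\mathcal U$ ranging over all finite open covers of $X$. The mean dimension of a single system is the case when $Y$ is a singleton; thus $\operatorname{mdim}(Z)=\sup_{\mathcal U}\lim_F\mathcal D(\mathcal U^F)/|F|$ over finite open covers $\mathcal U$ of $Z$, where $\mathcal D(\mathcal U)$ is the minimum of $\operatorname{ord}(\mathcal W)$ over finite open covers $\mathcal W$ of $Z$ refining $\mathcal U$. *)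

(* Defs.v *)
From mathcomp Require Import all_boot all_order all_algebra finmap.
From mathcomp Require Import all_classical all_reals all_analysis.

Set Implicit Arguments.
Unset Strict Implicit.
Unset Printing Implicit Defensive.

Import Order.TTheory GRing.Theory Num.Theory.
Import numFieldNormedType.Exports.

Local Open Scope classical_set_scope.
Local Open Scope ring_scope.

Definition almost_invariant (R : realType) (Gamma : groupType)
    (K : {fset Gamma}) (delta : R) : set {fset Gamma} :=
  [set F | F != fset0 /\
    (1 - delta) * (#|` F|)%:R <=
      (#|` [fset t in F | ([fset (k * t)%g | k in K] `<=` F)%fset]%fset|)%:R].

Definition amenable (R : realType) (Gamma : groupType) : Prop :=
  forall (K : {fset Gamma}) (delta : R), K != fset0 -> 0 < delta ->
    almost_invariant K delta !=set0.

(* The sets B(K, delta) = almost_invariant K delta, for K nonempty and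
   delta > 0, form a basis of this filter, so convergence of phi to c along it
   is exactly lim_F phi(F) = c. *)
Definition folner (R : realType) (Gamma : groupType) :
    set_system {fset Gamma} :=
  filter_from [set p : {fset Gamma} * R | p.1 != fset0 /\ 0 < p.2]
    (fun p => almost_invariant p.1 p.2).

Arguments folner : clear implicits.

Definition folner_lim (R : realType) (Gamma : groupType)
    (phi : {fset Gamma} -> R) : R :=
  lim (phi F @[F --> folner R Gamma]).

Definition metrizable (R : realType) (T : topologicalType) : Prop :=
  exists d : T -> T -> R,
    [/\ forall x, d x x = 0,
        forall x y, d x y = 0 -> x = y,
        forall x y, d x y = d y x,
        forall y x z, d x z <= d x y + d y z
      & forall x (A : set T),
          nbhs x A <-> exists2 e : R, 0 < e & [set y | d x y < e] `<=` A].

(* Gamma is discrete, so an action is continuous as soon as every group element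
   acts continuously. *)
Definition continuous_action (Gamma : groupType) (X : topologicalType)
    (a : Gamma -> X -> X) : Prop :=
  [/\ forall x, a 1%g x = x,
      forall g h x, a (g * h)%g x = a g (a h x)
    & forall g, continuous (a g)].

Definition dynamical_system (R : realType) (Gamma : groupType)
    (X : topologicalType) (a : Gamma -> X -> X) : Prop :=
  [/\ [set: X] !=set0, compact [set: X], metrizable R X
    & continuous_action a].

Definition factor_map (Gamma : groupType) (X Y : topologicalType)
    (aX : Gamma -> X -> X) (aY : Gamma -> Y -> Y) (pi : X -> Y) : Prop :=
  [/\ continuous pi, forall g x, pi (aX g x) = aY g (pi x)
    & forall y, exists x, pi x = y].

Definition diagonal_action (Gamma : groupType) (Y Z : Type)
    (aY : Gamma -> Y -> Y) (aZ : Gamma -> Z -> Z) :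
    Gamma -> Y * Z -> Y * Z :=
  fun g p => (aY g p.1, aZ g p.2).

Definition finite_open_cover (X : topologicalType) (U : set_system X) : Prop :=
  [/\ finite_set U, U `<=` open & \bigcup_(A in U) A = [set: X]].

Definition refines (X : Type) (U V : set_system X) : Prop :=
  forall A, U A -> exists2 B, V B & A `<=` B.

Definition fam_join (X : Type) (U V : set_system X) : set_system X :=
  [set A `&` B | A in U & B in V].

Definition fam_translate (Gamma : groupType) (X : Type) (a : Gamma -> X -> X)
    (s : Gamma) (U : set_system X) : set_system X :=
  [set a s @` A | A in U].

(* The join U^F of the s^-1 U; the neutral element {X} of the join is absorbed for nonempty F *)
Definition fam_pow (Gamma : groupType) (X : Type) (a : Gamma -> X -> X)
    (U : set_system X) (F : {fset Gamma}) : set_system X :=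
  \big[@fam_join X/[set [set: X]]]_(s <- F) fam_translate a s^-1%g U.

Definition fibers (X Y : Type) (pi : X -> Y) : set_system X :=
  [set pi @^-1` [set y] | y in [set: Y]].

Definition nat_max (S : set nat) : nat := xget 0%N [set n | S n /\ ubound S n].
Definition nat_min (S : set nat) : nat := xget 0%N [set n | S n /\ lbound S n].

(* The maximum is at least 1 for a cover of a nonempty space, hence the
   predecessor does not truncate there. *)
Definition ord (X : Type) (U : set_system X) : nat :=
  (nat_max [set (\big[addn/0%N]_(A \in U) (x \in A))%N | x in [set: X]]).-1.

Definition cover_dim (X : topologicalType) (U : set_system X) : nat :=
  nat_min [set ord W | W in [set W : set_system X |
    finite_open_cover W /\ refines W U]].

Definition cond_cover_dim (X : topologicalType) (Y : Type) (pi : X -> Y)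
    (U : set_system X) : nat :=
  nat_min [set ord W | W in [set W : set_system X |
    finite_open_cover W /\ refines (fam_join (fibers pi) W) U]].

Definition mdim (R : realType) (Gamma : groupType) (X : topologicalType)
    (a : Gamma -> X -> X) : \bar R :=
  ereal_sup [set (folner_lim (fun F =>
                    (cover_dim (fam_pow a U F))%:R / (#|` F|)%:R : R))%:E
            | U in [set U | finite_open_cover U]].

(* mdim(X | Y) for a factor map pi : X -> Y; the action on Y plays no role in
   its formula. *)
Definition cond_mdim (R : realType) (Gamma : groupType) (X : topologicalType)
    (Y : Type) (a : Gamma -> X -> X) (pi : X -> Y) : \bar R :=
  ereal_sup [set (folner_lim (fun F =>
                    (cond_cover_dim pi (fam_pow a U F))%:R / (#|` F|)%:R : R))%:E
            | U in [set U | finite_open_cover U]].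

Lemma metrizable_prod (R : realType) (Y Z : topologicalType) :
  metrizable R Y -> metrizable R Z -> metrizable R (Y * Z)%type.
Proof.
move=> [d [d0 dP dC dT dN]] [e [e0 eP eC eT eN]].
have dp x y : 0 <= d x y.
  have := dT y x x; rewrite d0 (dC y x) -mulr2n => h.
  by move: h; rewrite pmulrn_lge0.
have ep x y : 0 <= e x y.
  have := eT y x x; rewrite e0 (eC y x) -mulr2n => h.
  by move: h; rewrite pmulrn_lge0.
exists (fun p q => Num.max (d p.1 q.1) (e p.2 q.2)); split.
- by move=> p; rewrite d0 e0 maxxx.
- move=> [y z] [y' z'] /= h.
  have h1 : d y y' <= 0 by rewrite -h le_max lexx.
  have h2 : e z z' <= 0 by rewrite -h le_max lexx orbT.
  congr (_, _).
    by apply: dP; apply: le_anti; rewrite h1 dp.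
  by apply: eP; apply: le_anti; rewrite h2 ep.
- by move=> p q; rewrite dC eC.
- move=> q p r; rewrite ge_max; apply/andP; split.
    by apply: (le_trans (dT q.1 _ _)); apply: lerD; rewrite le_max lexx.
  by apply: (le_trans (eT q.2 _ _)); apply: lerD; rewrite le_max lexx orbT.
- move=> [y z] A; split.
    move=> [[B C] /= [/dN[r r0 rB] /eN[s s0 sC]] BCA].
    exists (Num.min r s); first by rewrite lt_min r0.
    move=> [y' z'] /=; rewrite gt_max !lt_min => /andP[/andP[h1 _] /andP[_ h2]].
    by apply: BCA; split; [exact: rB|exact: sC].
  move=> [r r0 rA].
  exists ([set y' | d y y' < r], [set z' | e z z' < r]) => /=.
    by split; [apply/dN; exists r|apply/eN; exists r].
  by move=> [y' z'] /= [h1 h2]; apply: rA; rewrite /= gt_max h1.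
Qed.

Lemma diagonal_system (R : realType) (Gamma : groupType)
    (Y Z : topologicalType) (aY : Gamma -> Y -> Y) (aZ : Gamma -> Z -> Z) :
  dynamical_system R aY -> dynamical_system R aZ ->
  dynamical_system R (diagonal_action aY aZ).
Proof.
move=> [[y _] cY mY [Y1 YM Yc]] [[z _] cZ mZ [Z1 ZM Zc]]; split.
- by exists (y, z).
- by rewrite -setXTT; exact: compact_setX.
- exact: metrizable_prod.
- split.
  + by move=> [u v]; rewrite /diagonal_action Y1 Z1.
  + by move=> g h [u v]; rewrite /diagonal_action YM ZM.
  + move=> g [u v]; apply: cvg_pair => /=.
      by apply: (@cvg_comp _ _ _ fst (aY g)); [exact: cvg_fst|exact: Yc].
    by apply: (@cvg_comp _ _ _ snd (aZ g)); [exact: cvg_snd|exact: Zc].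
Qed.

Lemma factor_map_fst (R : realType) (Gamma : groupType)
    (Y Z : topologicalType) (aY : Gamma -> Y -> Y) (aZ : Gamma -> Z -> Z) :
  dynamical_system R aZ ->
  factor_map (diagonal_action aY aZ) aY (fst : Y * Z -> Y).
Proof.
move=> [[z _] _ _ _]; split => //; last by move=> y; exists (y, z).
by move=> p; exact: cvg_fst.
Qed.

(* Main.v *)
(* A finite open cover V of Y * Z is refined on every slice {y} * Z by the same
   finite open cover U of Z, by compactness of Y and Z; then the U^F refine the
   V^F on slices, so D(V^F|Y) <= D(U^F) for all F.  Conversely D(U^F) is at most
   D(V^F|Y) when V is the preimage of U, as one sees by restricting covers to one
   slice.  Comparing the limits then requires their existence, that is the
   Ornstein-Weiss lemma.  Its hypothesis D(U \/ V) <= D(U) + D(V) is obtained by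
   a staircase subdivision, and the lemma itself by covering almost all of a very
   invariant set by translates of tiles of decreasing size, each tile covering a
   definite fraction of what the preceding ones have left. *)
Require Import Defs.
From mathcomp Require Import all_boot all_order all_algebra finmap.
From mathcomp Require Import all_classical all_reals all_analysis.
From mathcomp Require Import ring lra.

Set Implicit Arguments.
Unset Strict Implicit.
Unset Printing Implicit Defensive.

Import Order.TTheory GRing.Theory Num.Theory.
Import numFieldNormedType.Exports.

Local Open Scope classical_set_scope.
Local Open Scope ring_scope.

Definition rtranslate (G : groupType) (K : {fset G}) (c : G) : {fset G} :=
  [fset (k * c)%g | k in K]%fset.

(** The inner boundary of [A], which [almost_invariant] requires to be small; its size is bounded
    from above by listing the points that can lie in it. *)
Definition not_interior (G : groupType) (K A : {fset G}) : {fset G} :=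
  [fset t in A | ~~ (rtranslate K t `<=` A)%fset]%fset.

Definition tiles (G : groupType) (T C : {fset G}) : {fset G} :=
  (\bigcup_(c <- C) rtranslate T c)%fset.

(** * The Ornstein-Weiss lemma *)

Section FinsetsInGroups.
Variable G : groupType.
Implicit Types (K A C T : {fset G}).

Lemma rtranslateP K c x :
  reflect (exists2 k, k \in K & x = (k * c)%g) (x \in rtranslate K c).
Proof. exact: imfsetP. Qed.

Lemma card_rtranslate K c : #|` rtranslate K c| = #|` K|.
Proof. by rewrite card_imfset //; exact: mulIg. Qed.

Lemma tilesP T C x :
  reflect (exists2 c, c \in C & x \in rtranslate T c) (x \in tiles T C).
Proof.
apply: (iffP (bigfcupP _ _ _ _)).
  by move=> [c /andP[cC _] xc]; exists c.
by move=> [c cC xc]; exists c => //; rewrite cC.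
Qed.

Lemma tilesU1 T C c : tiles T (c |` C)%fset = (rtranslate T c `|` tiles T C)%fset.
Proof.
apply/fsetP => x; rewrite in_fsetU; apply/tilesP/orP.
  move=> [c']; rewrite in_fset1U => /orP[/eqP -> ->|c'C xc']; first by left.
  by right; apply/tilesP; exists c'.
move=> [xc|/tilesP[c' c'C xc']]; first by exists c; rewrite ?fset1U1.
by exists c' => //; rewrite in_fset1U c'C orbT.
Qed.

Lemma tiles0 T : tiles T fset0 = fset0.
Proof. by apply/fsetP => x; rewrite in_fset0; apply/negP => /tilesP[]. Qed.

Lemma not_interiorP K A t :
  reflect (t \in A /\ exists2 k, k \in K & (k * t)%g \notin A)
    (t \in not_interior K A).
Proof.
rewrite !inE /=; apply: (iffP andP) => -[tA h]; split => //.
  have /fsubsetPn[x /rtranslateP[k kK ->] kA] := h.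
  by exists k.
case: h => k kK kA; apply/fsubsetPn; exists (k * t)%g => //.
by apply/rtranslateP; exists k.
Qed.

Lemma card_interior K A :
  (#|` [fset t in A | ([fset (k * t)%g | k in K] `<=` A)%fset]%fset|
   + #|` not_interior K A| = #|` A|)%N.
Proof.
rewrite -(cardfsID [fset t in A | (rtranslate K t `<=` A)%fset]%fset A).
congr (_ + _)%N; congr (#|` _|); apply/fsetP => x; rewrite !inE.
  by rewrite andbA andbb.
by rewrite negb_and andb_orl andNb /= andbC.
Qed.

Lemma almost_invariantE (R : realType) K (d : R) A :
  almost_invariant K d A <->
  A != fset0 /\ (#|` not_interior K A|)%:R <= d * (#|` A|)%:R.
Proof.
rewrite /almost_invariant /=; have := card_interior K A.
move=> /(congr1 (fun n => n%:R : R)); rewrite natrD => h.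
by split=> -[A0 h2]; split=> //; lra.
Qed.

Lemma almost_invariantS (R : realType) K1 K2 (d1 d2 : R) :
  (K1 `<=` K2)%fset -> d2 <= d1 ->
  almost_invariant K2 d2 `<=` almost_invariant K1 d1.
Proof.
move=> sK dd A /almost_invariantE[A0 h]; apply/almost_invariantE; split => //.
apply: (@le_trans _ _ (#|` not_interior K2 A|)%:R).
  rewrite ler_nat; apply: fsubset_leq_card; apply/fsubsetP => t.
  move=> /not_interiorP[tA [k kK kA]]; apply/not_interiorP; split => //.
  by exists k => //; exact: (fsubsetP sK).
by apply: (le_trans h); rewrite ler_wpM2r.
Qed.

Lemma card_overlap T t E :
  (#|` (rtranslate T t `&` E)%fset| <= \sum_(k <- T) ((k * t)%g \in E))%N.
Proof.
have -> : (\sum_(k <- T) ((k * t)%g \in E))%N =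
    #|` [fset k in T | (k * t)%g \in E]%fset|.
  by rewrite -big_mkcond /= card_fset_sum1 [RHS]big_fset.
rewrite -(card_rtranslate [fset _ in _ | _]%fset t).
apply: fsubset_leq_card; apply/fsubsetP => x.
rewrite in_fsetI => /andP[/rtranslateP[k kT ->] kE].
by apply/rtranslateP; exists k => //; rewrite !inE /= kT.
Qed.

(** Count the pairs with [k * t] in [E]: for fixed [k] the map sending [t] to [k * t] is injective,
    so each [k] accounts for at most [|E|] of them. *)
Lemma sum_overlap T (I : {fset G}) E :
  (\sum_(t <- I) #|` (rtranslate T t `&` E)%fset| <= #|` T| * #|` E|)%N.
Proof.
apply: (@leq_trans (\sum_(t <- I) \sum_(k <- T) ((k * t)%g \in E))%N).
  by apply: leq_sum => t _; exact: card_overlap.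
rewrite exchange_big /= card_fset_sum1 big_distrl /=; apply: leq_sum => k _.
rewrite mul1n -big_mkcond /=.
have -> : (\sum_(t <- I | (k * t)%g \in E) 1)%N =
    #|` [fset (k * t)%g | t in [fset t in I | (k * t)%g \in E]%fset]%fset|.
  rewrite card_imfset; last by move=> u v /mulgI.
  by rewrite card_fset_sum1 [RHS]big_fset.
apply: fsubset_leq_card; apply/fsubsetP => x /imfsetP[t /=].
by rewrite !inE /= => /andP[_ kE ->].
Qed.

(* Greedy covering: if C is a maximal set of centres whose tiles overlap little,
   then every translate of T inside A meets the union of the tiles in at least
   e |T| points, and double counting bounds this union from below. *)
Lemma maximal_tiles (R : realType) T A (e : R) :
  T != fset0 -> 0 < e <= 1 -> exists2 C,
    (tiles T C `<=` A)%fset /\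
    (1 - e) * (#|` C|)%:R * (#|` T|)%:R <= (#|` tiles T C|)%:R &
    e * (#|` A|%:R - #|` not_interior T A|%:R) <= (#|` tiles T C|)%:R.
Proof.
move=> T0 /andP[e0 e1].
have Tgt0 : 0 < #|` T|%:R :> R by rewrite ltr0n cardfs_gt0.
pose good C := [/\ (C `<=` A)%fset, (tiles T C `<=` A)%fset &
   (1 - e) * (#|` C|)%:R * (#|` T|)%:R <= (#|` tiles T C|)%:R].
pose P n := `[< exists2 C, good C & #|` C| = n >].
have exP : exists n, P n.
  exists 0%N; apply/asboolP; exists fset0; last exact: cardfs0.
  by split; rewrite ?tiles0 ?fsub0set // cardfs0 mulr0 mul0r.
have ubP n : P n -> (n <= #|` A|)%N.
  by move=> /asboolP[C [CA _ _] <-]; exact: fsubset_leq_card.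
have [m /asboolP[C [CA TA gC] Cm] maxm] := ex_maxnP exP ubP.
exists C => //; set E := tiles T C in TA gC *.
pose I := [fset t in A | (rtranslate T t `<=` A)%fset]%fset.
have sat t : t \in I -> e * #|` T|%:R <= #|` (rtranslate T t `&` E)%fset|%:R.
  rewrite !inE /= => /andP[tA tTA].
  case: (leP (e * #|` T|%:R) _) => // lt.
  have tC : t \notin C.
    apply/negP => tC; move: lt; have /fsetIidPl -> : (rtranslate T t `<=` E)%fset.
      by apply/fsubsetP => x xt; apply/tilesP; exists t.
    by rewrite card_rtranslate ltNge ler_piMl.
  (* The translate at [t] adds at least [(1 - e) |T|] new points, so [t] could join [C], against
     maximality. *)
  have : P m.+1.
    apply/asboolP; exists (t |` C)%fset; last by rewrite cardfsU1 tC Cm.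
    split; rewrite ?tilesU1 ?fsubUset ?fsub1set ?tA ?tTA //=.
    rewrite cardfsU1 tC natrD -/E.
    have := cardfsUI (rtranslate T t) E; rewrite card_rtranslate.
    move=> /(congr1 (fun n => n%:R : R)); rewrite !natrD mulr1n mulrDr mulr1 mulrDl => h.
    lra.
  by move/maxm; rewrite ltnn.
have IA : #|` I|%:R + #|` not_interior T A|%:R = #|` A|%:R :> R.
  by rewrite -natrD (card_interior T A).
have -> : #|` A|%:R - #|` not_interior T A|%:R = #|` I|%:R :> R.
  by rewrite -IA addrK.
rewrite -(ler_pM2l Tgt0).
apply: (@le_trans _ _ (\sum_(t <- I) e * #|` T|%:R)).
  rewrite mulrA (mulrC _ e) (card_fset_sum1 I) natr_sum big_distrr /=.
  by under eq_bigr do rewrite mulr1.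
rewrite -natrM.
apply: (@le_trans _ _ (\sum_(t <- I) #|` (rtranslate T t `&` E)%fset|)%:R).
  rewrite natr_sum big_seq [leRHS]big_seq; apply: ler_sum => t; exact: sat.
by rewrite ler_nat; exact: sum_overlap.
Qed.

(** If [k * t] leaves the remainder but stays in [A], it is some [u * c] in a tile. Then [k^-1 * u]
    is outside [T], as [t] is uncovered, and [t] is determined by [(k, u, c)]. *)
Lemma not_interior_remainder K T A C :
  (#|` not_interior K (A `\` tiles T C)%fset| <=
   #|` not_interior K A| +
   #|` K| * #|` not_interior [fset (k^-1)%g | k in K]%fset T| * #|` C|)%N.
Proof.
set B := not_interior [fset _ | _ in K]%fset T.
pose D := [seq (p.1^-1 * p.2 * c)%g | p <- [seq (k, u) | k <- K, u <- B], c <- C].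
have -> : (#|` K| * #|` B| * #|` C|)%N = size D by rewrite !size_allpairs.
rewrite -size_cat; apply: uniq_leq_size; first exact: fset_uniq.
move=> t /not_interiorP[]; rewrite in_fsetD => /andP[tE tA] [k kK].
rewrite in_fsetD negb_and negbK mem_cat => /orP[ktE|ktA]; last first.
  by apply/orP; left; apply/not_interiorP; split => //; exists k.
apply/orP; right; have /tilesP[c cC /rtranslateP[u uT ktu]] := ktE.
have tu : t = (k^-1 * u * c)%g by rewrite -mulgA -ktu mulKg.
apply/allpairsP; exists ((k, u), c); split => //=; apply: allpairs_f => //.
apply/not_interiorP; split => //; exists k^-1%g; first by apply/imfsetP; exists k.
apply: contra tE => kuT; apply/tilesP; exists c => //.
by apply/rtranslateP; exists (k^-1 * u)%g.
Qed.

End FinsetsInGroups.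

Lemma almost_invariantI (R : realType) (G : groupType) (K1 K2 : {fset G}) (d1 d2 : R) :
  almost_invariant (K1 `|` K2)%fset (Num.min d1 d2) `<=`
  almost_invariant K1 d1 `&` almost_invariant K2 d2.
Proof.
move=> A AI; split; apply: almost_invariantS AI; rewrite ?fsubsetUl ?fsubsetUr //.
  by rewrite ge_min lexx.
by rewrite ge_min lexx orbT.
Qed.

Lemma folner_proper (R : realType) (G : groupType) :
  amenable R G -> ProperFilter (folner R G).
Proof.
move=> G_amenable; apply: filter_from_proper; last first.
  by move=> [K d] /= [K0 d0]; exact: G_amenable.
apply: filter_from_filter; first exists ([fset 1%g]%fset, 1) => /=.
  by split=> //; apply/fset0Pn; exists 1%g; rewrite inE.
move=> [K1 d1] [K2 d2] /= [K10 d10] [K20 d20].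
exists ((K1 `|` K2)%fset, Num.min d1 d2) => /=; last exact: almost_invariantI.
by rewrite fsetU_eq0 negb_and K10 lt_min d10 d20.
Qed.

(** * Quasi-tilings and limits of subadditive functions *)

Section OrnsteinWeiss.
Variables (R : realType) (G : groupType) (phi : {fset G} -> R).
Hypothesis G_amenable : amenable R G.
Hypothesis phi_ge0 : forall A, 0 <= phi A.
Hypothesis phi0 : phi fset0 = 0.
Hypothesis phiU : forall A B, phi (A `|` B)%fset <= phi A + phi B.
Hypothesis phiM : forall A c, phi (rtranslate A c) <= phi A.

Lemma subadditive_le_card A : phi A <= phi [fset 1%g]%fset * #|` A|%:R.
Proof.
elim/finSet_rect: A => A IH.
have [->|/fset0Pn[x xA]] := eqVneq A fset0; first by rewrite phi0 cardfs0 mulr0.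
rewrite -(fsetD1K xA); apply: (le_trans (phiU _ _)).
have h := IH _ (fproperD1 xA).
rewrite cardfsU1 in_fsetD1 eqxx /= natrD mulrDr mulr1; apply: lerD => //.
apply: le_trans (phiM _ x); rewrite le_eqVlt; apply/orP; left; apply/eqP.
congr phi; apply/fsetP => y; rewrite in_fset1; apply/eqP/rtranslateP.
  by move=> ->; exists 1%g; rewrite ?fset11 ?mul1g.
by move=> [k]; rewrite in_fset1 => /eqP ->; rewrite mul1g.
Qed.

Lemma subadditive_tiles T C : phi (tiles T C) <= #|` C|%:R * phi T.
Proof.
elim/finSet_rect: C => C IH.
have [->|/fset0Pn[x xC]] := eqVneq C fset0.
  by rewrite tiles0 phi0 cardfs0 mul0r.
rewrite -(fsetD1K xC) tilesU1; apply: (le_trans (phiU _ _)).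
rewrite cardfsU1 in_fsetD1 eqxx /= natrD mulrDl mul1r; apply: lerD => //.
exact: IH (fproperD1 xC).
Qed.

(** Each round tiles a proportion at least [e / 2] of the current set. The tile of a round is chosen
    after the [(K, d)] of the later rounds, invariant enough that the remainder is
    [(K, d)]-invariant, unless this remainder is already below [e |A|]. *)
Lemma quasi_tiling (a e : R) (n : nat) : 0 <= a -> 0 < e <= 1 / 2 ->
  (forall K (d : R), K != fset0 -> 0 < d ->
     exists2 T, almost_invariant K d T & phi T <= a * #|` T|%:R) ->
  exists K : {fset G}, exists2 d : R, K != fset0 /\ 0 < d &
    forall A, almost_invariant K d A ->
    exists E, [/\ (E `<=` A)%fset, phi E <= a / (1 - e) * #|` E|%:R &
      #|` (A `\` E)%fset|%:R <= Num.max ((1 - e / 2) ^+ n) e * #|` A|%:R].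
Proof.
move=> a0 /andP[e0 e1] tile.
have e1' : 0 < 1 - e by lra.
elim: n => [|n [K [d [K0 d0] IH]]].
  exists [fset 1%g]%fset; exists 1.
    by split => //; apply/fset0Pn; exists 1%g; rewrite inE.
  move=> A _; exists fset0; rewrite fsub0set phi0 cardfs0 mulr0 fsetD0; split => //.
  by rewrite expr0 -{1}[X in X <= _]mul1r ler_wpM2r // le_max lexx.
pose K' := [fset (k^-1)%g | k in K]%fset.
have K'0 : K' != fset0.
  by move/fset0Pn: K0 => [k kK]; apply/fset0Pn; exists k^-1%g; apply/imfsetP; exists k.
have Kgt0 : 0 < #|` K|%:R :> R by rewrite ltr0n cardfs_gt0.
(* With [|C| |T| <= 2 |A|], the tile boundaries then contribute at most [d * e / 2 * |A|] to the
   boundary of the remainder. *)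
pose eta := d * e / (4 * #|` K|%:R).
have eta0 : 0 < eta by rewrite divr_gt0 // mulr_gt0.
have [T /almost_invariantE[T0 TI] phiT] := tile K' eta K'0 eta0.
(* The bound [1 / 2] lets the tiles cover [e / 2] of [A]; [d * e / 2] is the other half of the
   boundary budget [d * e]. *)
exists (T `|` K)%fset; exists (Num.min (1 / 2) (d * e / 2)).
  split; last by rewrite lt_min !divr_gt0 // mulr_gt0.
  by rewrite fsetU_eq0 negb_and T0.
move=> A /almost_invariantI[/almost_invariantE[A0 AT] /almost_invariantE[_ AK]].
have [|C [CA gC] CE] := @maximal_tiles _ R T A e T0; first by rewrite e0; lra.
have Agt0 : 0 < #|` A|%:R :> R by rewrite ltr0n cardfs_gt0.
have := not_interior_remainder K T A C; rewrite -/K'.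
set E := tiles T C in CA gC CE * => rem.
have cardD : #|` (A `\` E)%fset|%:R = #|` A|%:R - #|` E|%:R :> R.
  have := cardfsID E A; have /fsetIidPr -> := CA.
  by move=> /(congr1 (fun n => n%:R : R)); rewrite natrD => <-; rewrite addrC addKr.
have phiE : phi E <= a / (1 - e) * #|` E|%:R.
  apply: (le_trans (subadditive_tiles T C)).
  apply: (@le_trans _ _ (#|` C|%:R * (a * #|` T|%:R))); first by rewrite ler_wpM2l.
  rewrite mulrAC ler_pdivlMr //.
  have -> : #|` C|%:R * (a * #|` T|%:R) * (1 - e) =
     a * ((1 - e) * #|` C|%:R * #|` T|%:R) by ring.
  by rewrite ler_wpM2l.
have EA : #|` E|%:R <= #|` A|%:R :> R by rewrite ler_nat fsubset_leq_card.
have dec : #|` (A `\` E)%fset|%:R <= (1 - e / 2) * #|` A|%:R :> R.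
  by rewrite cardD; nra.
(* In the second case [|A|] is less than [1 / e] times the remainder, so a boundary of at most
   [d * e * |A|] is small relative to the remainder. *)
have [small|big] := leP (#|` (A `\` E)%fset|%:R : R) (e * #|` A|%:R).
  exists E; split => //; apply: (le_trans small).
  by rewrite ler_wpM2r // le_max lexx orbT.
have mT : #|` C|%:R * #|` T|%:R <= 2 * #|` A|%:R :> R.
  by have : 0 <= #|` C|%:R * #|` T|%:R :> R by []; nra.
have AI' : almost_invariant K d (A `\` E)%fset.
  apply/almost_invariantE; split.
    by rewrite -cardfs_gt0 -(ltr0n R); apply: lt_trans big; rewrite mulr_gt0.
  apply: (@le_trans _ _ (d * (e * #|` A|%:R))); last by rewrite ler_wpM2l // ltW.
  move: rem; rewrite -(ler_nat R) natrD !natrM => /le_trans; apply.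
  have h1 : #|` K|%:R * #|` not_interior K' T|%:R * #|` C|%:R <= (d * e / 2) * #|` A|%:R.
    apply: (@le_trans _ _ (#|` K|%:R * (eta * #|` T|%:R) * #|` C|%:R)).
      by rewrite ler_wpM2r // ler_wpM2l.
    have -> : #|` K|%:R * (eta * #|` T|%:R) * #|` C|%:R =
      (d * e / 4) * (#|` C|%:R * #|` T|%:R) :> R.
      by rewrite /eta; field; rewrite gt_eqF.
    apply: (@le_trans _ _ (d * e / 4 * (2 * #|` A|%:R))); last by lra.
    by rewrite ler_wpM2l // ltW // divr_gt0 // mulr_gt0.
  by lra.
have [E' [E'A phiE' dec']] := IH _ AI'.
have dEE' : (E `&` E')%fset = fset0.
  apply/fsetP => x; rewrite in_fset0 in_fsetI; apply/negP => /andP[xE xE'].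
  by have := fsubsetP E'A _ xE'; rewrite in_fsetD xE.
exists (E `|` E')%fset; split.
- by rewrite fsubUset CA (fsubset_trans E'A) // fsubsetDl.
- apply: (le_trans (phiU _ _)); have := cardfsUI E E'.
  rewrite dEE' cardfs0 addn0 => ->; rewrite natrD mulrDr; exact: lerD.
- rewrite -fsetDDl; apply: (le_trans dec').
  have -> : Num.max ((1 - e / 2) ^+ n.+1) e * #|` A|%:R =
    Num.max ((1 - e / 2) ^+ n.+1) e / (1 - e / 2) * ((1 - e / 2) * #|` A|%:R).
    by field; apply/eqP => h; lra.
  apply: ler_pM => //; first by rewrite le_max (ltW e0) orbT.
  rewrite ler_pdivlMr; last by lra.
  rewrite maxr_pMl; last by lra.
  rewrite ge_max !le_max exprSr lexx /=; apply/orP; right.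
  by rewrite ler_piMr; lra.
Qed.

(* Its infimum is the limit inferior of phi F / |F|. *)
Let S : set R := [set a | 0 <= a /\ forall (K : {fset G}) (d : R), K != fset0 -> 0 < d ->
  exists2 T, almost_invariant K d T & phi T <= a * #|` T|%:R].

(** A quasi-tiling costs at most [a / (1 - e)] per covered point, and the remaining proportion [e]
    at most [phi [fset 1%g]] per point. *)
Lemma eventually_ratio_le (a r : R) : S a -> a < r ->
  \forall F \near folner R G, phi F / #|` F|%:R <= r.
Proof.
move=> [a0 tile] ar.
set C := phi [fset 1%g]%fset.
have C0 : 0 <= C by exact: phi_ge0.
(* As [1 / (1 - e) <= 1 + 2 * e] for [e <= 1 / 2], the ratio is at most [a + e * (2 * a + C)]; the
   extra 1 keeps the denominator positive. *)
pose e := Num.min (1 / 2) ((r - a) / (2 * a + C + 1)).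
have D0 : 0 < 2 * a + C + 1 by lra.
have e0 : 0 < e by rewrite lt_min !divr_gt0 ?subr_gt0.
have e2 : e <= 1 / 2 by rewrite ge_min lexx.
have eD : e * (2 * a + C + 1) <= r - a by rewrite -ler_pdivlMr // ge_min lexx orbT.
have [n ne] : exists n, (1 - e / 2) ^+ n <= e.
  have : (fun n => (1 - e / 2) ^+ n) @ \oo --> (0 : R).
    by apply: cvg_expr; rewrite ger0_norm; lra.
  move=> /cvgr0_norm_le /(_ e e0) /filter_ex[n /= h]; exists n.
  by apply: le_trans h; exact: ler_norm.
have [|K [d [K0 d0] H]] := @quasi_tiling a e n a0 _ tile; first by rewrite e0.
exists (K, d) => //= A AI; have [E [EA phiE AE]] := H A AI.
have [A0 _] := AI.
have Agt0 : 0 < #|` A|%:R :> R by rewrite ltr0n cardfs_gt0.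
rewrite ler_pdivrMr //.
have EA' : #|` E|%:R <= #|` A|%:R :> R by rewrite ler_nat fsubset_leq_card.
have h1 : phi A <= phi E + phi (A `\` E)%fset.
  suff {1}-> : A = (E `|` A `\` E)%fset by exact: phiU.
  apply/fsetP => x; rewrite in_fsetU in_fsetD.
  by case: (boolP (x \in E)) => //= /(fsubsetP EA).
have h2 := subadditive_le_card (A `\` E)%fset.
move: AE; rewrite (max_idPr ne) => AE.
have h3 : a / (1 - e) <= a + 2 * e * a.
  have : 0 <= a * e * (1 - 2 * e) by rewrite !mulr_ge0 //; lra.
  by rewrite ler_pdivrMr; lra.
have h4 : a / (1 - e) * #|` E|%:R <= (a + 2 * e * a) * #|` A|%:R.
  apply: ler_pM => //; apply: divr_ge0 => //; lra.
have h5 : C * #|` (A `\` E)%fset|%:R <= C * (e * #|` A|%:R) by rewrite ler_wpM2l.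
have h6 : e * (2 * a + C) <= r - a by nra.
have h7 : e * (2 * a + C) * #|` A|%:R <= (r - a) * #|` A|%:R by rewrite ler_wpM2r.
rewrite /C in h5 h7 *; lra.
Qed.

(** The limit is [inf S]. Elements of [S] near it bound the ratio from above; a number below it is
    not in [S], and the [(K, d)] witnessing this bounds the ratio from below. *)
Theorem ornstein_weiss : cvg (phi F / #|` F|%:R @[F --> folner R G]).
Proof.
have FF := folner_proper G_amenable.
have SC : S (phi [fset 1%g]%fset).
  split=> // K d K0 d0; have [T TI] := G_amenable K0 d0.
  by exists T => //; exact: subadditive_le_card.
have lbS : lbound S 0 by move=> a [].
have Sinf : has_inf S by split; [exists (phi [fset 1%g]%fset)|exists 0].
apply/cvg_ex; exists (inf S); apply/cvgrPdist_le => r r0.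
have [a Sa ar] := inf_adherent r0 Sinf.
have up := eventually_ratio_le Sa ar.
have lo : \forall F \near folner R G, inf S - r <= phi F / #|` F|%:R.
  (* A negative number is outside [S] only by its sign and provides no [(K, d)], but then the lower
     bound is immediate. *)
  have [l0|l0] := ltP (inf S - r) 0.
    by apply: nearW => F; apply: (le_trans (ltW l0)); rewrite divr_ge0.
  have : ~ S (inf S - r).
    by move=> /(ge_inf Sinf.2); lra.
  move=> /not_andP[//|/existsNP[K /existsNP[d /not_implyP[K0 /not_implyP[d0 H]]]]].
  exists (K, d) => //= F FI; have [F0 _] := FI.
  rewrite ler_pdivlMr ?ltr0n ?cardfs_gt0 //; apply/ltW; rewrite ltNge.
  by apply/negP => h; apply: H; exists F.
near=> F; rewrite distrC ler_norml; apply/andP; split.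
  have : inf S - r <= phi F / #|` F|%:R by near: F.
  by lra.
have : phi F / #|` F|%:R <= inf S + r by near: F.
by lra.
Unshelve. all: by end_near. Qed.

End OrnsteinWeiss.

(** * Order of covers *)

Section NatExtrema.

Lemma nat_minP (S : set nat) : S !=set0 -> S (nat_min S) /\ lbound S (nat_min S).
Proof.
move=> [n Sn]; have exS : exists n, `[< S n >] by exists n; apply/asboolP.
case: (ex_minnP exS) => m /asboolP Sm min_m.
have : S m /\ lbound S m by split => // k Sk; apply: min_m; apply/asboolP.
exact: (@xgetI _ 0%N [set n | S n /\ lbound S n] m).
Qed.

Lemma nat_maxP (S : set nat) m : S !=set0 -> ubound S m ->
  S (nat_max S) /\ ubound S (nat_max S).
Proof.
move=> [n Sn] Sm; have exS : exists n, `[< S n >] by exists n; apply/asboolP.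
have ubS k : `[< S k >] -> (k <= m)%N by move=> /asboolP; exact: Sm.
case: (ex_maxnP exS ubS) => k /asboolP Sk max_k.
have : S k /\ ubound S k by split => // l Sl; apply: max_k; apply/asboolP.
exact: (@xgetI _ 0%N [set n | S n /\ ubound S n] k).
Qed.

(** If [S] has no maximum, [nat_max S] is the default 0. *)
Lemma nat_max_le (S : set nat) m : ubound S m -> (nat_max S <= m)%N.
Proof. by move=> Sm; rewrite /nat_max; case: xgetP => // k _ [/Sm]. Qed.

End NatExtrema.

(** Common form of [cover_dim] and [cond_cover_dim], with [P] the family of sets admissible in a
    cover. *)
Definition min_ord (X : topologicalType) (P : set_system X) : nat :=
  nat_min [set ord W | W in [set W | finite_open_cover W /\ W `<=` P]].

(** Indexing lets preimages and products repeat members, counted with repetition. The bound [n.+1]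
    matches [ord], which is the multiplicity minus one. *)
Definition has_cover (X : topologicalType) (P : set_system X) (n : nat) : Prop :=
  exists (I : finType) (g : I -> set X),
    [/\ forall i, open (g i), forall i, P (g i), forall x, exists i, g i x &
        forall x, (#|[pred i | x \in g i]| <= n.+1)%N].

Section Covers.
Variable X : topologicalType.
Implicit Types P Q W : set_system X.

Lemma multiplicityE W x : finite_set W ->
  (\big[addn/0%N]_(A \in W) (x \in A))%N = #|[pred A : fset_set W | x \in fsval A]|.
Proof.
move=> finW; rewrite fsbig_finite // big_seq_fsetE /= -sum1_card [RHS]big_mkcond /=.
by apply: eq_bigr => A _; rewrite inE; case: (x \in _).
Qed.

(** Passing to the range merges equal members and can only lower multiplicities; conversely [W] is
    indexed by itself. *)
Lemma has_cover_ord P n : has_cover P n <->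
  exists W, [/\ finite_open_cover W, W `<=` P & (ord W <= n)%N].
Proof.
split=> [[I [g [og Pg cg ng]]]|[W [[finW oW cW] WP Wn]]].
  have finW : finite_set (range g) by exact: finite_image.
  exists (range g); split.
  - split => //; first by move=> _ [i _ <-].
    by apply/seteqP; split=> // x _; have [i gi] := cg x; exists (g i) => //; exists i.
  - by move=> _ [i _ <-].
  - rewrite /ord -subn1 leq_subLR add1n; apply: nat_max_le => _ [x _ <-].
    rewrite multiplicityE //; apply: leq_trans (ng x).
    rewrite !cardE -(size_map (fun A : fset_set (range g) => fsval A)) -(size_map g).
    apply: uniq_leq_size.
      by rewrite map_inj_uniq ?enum_uniq //; exact: val_inj.
    move=> _ /mapP[A + ->]; rewrite mem_enum inE => xA.
    have := fsvalP A; rewrite in_fset_set // inE => -[i _ giA].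
    by apply/mapP; exists i; rewrite ?giA // mem_enum inE giA.
exists (fset_set W : finType), (fun A => fsval A).
have WfsetW (A : fset_set W) : W (fsval A).
  by have := fsvalP A; rewrite in_fset_set // inE.
split=> [A|A|x|x]; [exact: oW|exact: WP| |].
  have [A WA Ax] : (\bigcup_(A in W) A) x by rewrite cW.
  have AW : A \in fset_set W by rewrite in_fset_set // inE.
  by exists [` AW]%fset.
rewrite -multiplicityE //.
set S := [set (\big[addn/0%N]_(A \in W) (y \in A))%N | y in [set: X]].
have neS : S !=set0 by exists (\big[addn/0%N]_(A \in W) (x \in A))%N; exists x.
have ubS : ubound S #|{: fset_set W}|.
  by move=> _ [y _ <-]; rewrite multiplicityE //; exact: max_card.
have [_ h] := nat_maxP neS ubS.
apply: (@leq_trans (nat_max S)); first by apply: h; exists x.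
by apply: (leq_trans (leqSpred _)); rewrite ltnS.
Qed.

Lemma has_cover_min_ord P n : has_cover P n ->
  has_cover P (min_ord P) /\ (min_ord P <= n)%N.
Proof.
move=> /has_cover_ord[W [oW WP Wn]].
have [|[V [oV VP] Vm] min_m] :=
    @nat_minP [set ord W | W in [set W | finite_open_cover W /\ W `<=` P]].
  by exists (ord W), W.
split; first by apply/has_cover_ord; exists V; split=> //; rewrite Vm.
by apply: leq_trans Wn; apply: min_m; exists W.
Qed.

Lemma min_ord_le P n : has_cover P n -> (min_ord P <= n)%N.
Proof. by case/has_cover_min_ord. Qed.

Lemma has_cover_sub P Q n : P `<=` Q -> has_cover P n -> has_cover Q n.
Proof.
move=> PQ [I [g [og Pg cg ng]]]; exists I, g; split=> // i.
by apply: PQ; exact: Pg.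
Qed.

Lemma has_coverT P : P setT -> has_cover P 0.
Proof.
move=> PT; exists unit, (fun=> setT); split=> [_|_||]; [exact: openT|exact: PT| |].
- by move=> x; exists tt.
- by move=> x; rewrite (leq_trans (max_card _)) ?card_unit.
Qed.

End Covers.

Lemma has_cover_preimage (X Y : topologicalType) (f : X -> Y)
    (P : set_system X) (Q : set_system Y) n :
  continuous f -> (forall A, Q A -> P (f @^-1` A)) -> has_cover Q n -> has_cover P n.
Proof.
move=> cf QP [I [g [og Qg cg ng]]]; exists I, (fun i => f @^-1` (g i)); split.
- by move=> i; apply: open_comp => // x _; exact: cf.
- by move=> i; exact: QP.
- by move=> x; exact: cg.
- by move=> x; exact: (ng (f x)).
Qed.

(** * Subadditivity of the order of covers *)

Section Staircase.
Variables (R : realType) (X : topologicalType).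

(* The supremum of the radii at most 1 of the balls at x contained in A; unlike
   the distance to the complement, it needs no convention when A is everything. *)
Definition depth (d : X -> X -> R) (A : set X) (x : X) : R :=
  sup [set r | 0 <= r <= 1 /\ forall y, d x y < r -> A y].

Lemma open_cozero (A : set X) : metrizable R X -> open A ->
  exists f : X -> R,
    [/\ continuous f, forall x, 0 <= f x & forall x, (0 < f x) <-> A x].
Proof.
move=> [d [d0 _ dC dT dN]] oA; exists (depth d A).
pose S x := [set r : R | 0 <= r <= 1 /\ forall y, d x y < r -> A y].
have d_ge0 x y : 0 <= d x y.
  by have := dT y x x; rewrite d0 (dC y x); lra.
have S0 x : S x 0 by split; [lra|move=> y; rewrite ltNge d_ge0].
have supS x : has_sup (S x).
  by split; [exists 0|exists 1 => r [/andP[]]].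
have f_ge0 x : 0 <= depth d A x by exact: (sup_upper_bound (supS x)) (S0 x).
(* Decreasing an admissible radius at [x] by [d x y] gives one at [y]: [depth] is 1-Lipschitz, hence
   continuous. *)
have lip x y : depth d A x <= depth d A y + d x y.
  apply: ge_sup; first by exists 0; exact: S0.
  move=> r [r01 Ar]; have [lt|ge] := ltP r (d x y).
    by have := f_ge0 y; lra.
  rewrite -lerBlDr; apply: (sup_upper_bound (supS y)); split.
    by have := d_ge0 x y; lra.
  by move=> z yz; apply: Ar; have := dT y x z; lra.
split => // [x|x].
  apply/cvgrPdist_lt => e e0; apply/dN; exists e => // y /= xy.
  rewrite ltr_norml; have := lip x y; have := lip y x; rewrite (dC y x); lra.
split=> [fx|Ax].
  have [r [_ Ar] r0] := sup_gt (proj1 (supS x)) fx.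
  by apply: Ar; rewrite d0.
have /dN[e e0 eA] : nbhs x A by exact: open_nbhs_nbhs.
apply: (@lt_le_trans _ _ (Num.min e 1)); first by rewrite lt_min e0 ltr01.
apply: (sup_upper_bound (supS x)); split.
  by rewrite le_min ge_min lexx orbT (ltW e0) ler01.
by move=> y; rewrite lt_min => /andP[/eA].
Qed.

(** Intervals of lengths [f i x] are laid end to end from 0 in the enumeration order of [I]; [s i x]
    is the left endpoint of the one of index [i]. *)
Lemma partial_sums (I : finType) (f : I -> X -> R) :
  (forall i, continuous (f i)) -> (forall i x, 0 <= f i x) ->
  exists s : I -> X -> R, [/\ forall i, continuous (s i), forall i x, 0 <= s i x,
    forall i j x, i != j -> s i x + f i x <= s j x \/ s j x + f j x <= s i x
    & forall x, (exists i, 0 < f i x) -> exists2 i, s i x = 0 & 0 < f i x].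
Proof.
move=> cf f0.
exists (fun i x => \sum_(k | (enum_rank k < enum_rank i)%N) f k x); split.
- move=> i; apply: continuous_big => [|k _]; [exact: add_continuous|exact: cf].
- by move=> i x; apply: sumr_ge0.
- move=> i j x ij; wlog : i j ij / (enum_rank i < enum_rank j)%N => [h|lt].
    have [lt|lt|e] := ltngtP (enum_rank i) (enum_rank j).
    + exact: h.
    + by rewrite or_comm; apply: h; rewrite // eq_sym.
    + by case/eqP: ij; apply: enum_rank_inj; exact: val_inj.
  left; rewrite [leRHS](bigD1 i) //= addrC lerD2r.
  rewrite [leRHS](bigID (fun k => (enum_rank k < enum_rank i)%N)) /=.
  rewrite -[leLHS]addr0; apply: lerD; last exact: sumr_ge0.
  rewrite le_eqVlt; apply/orP; left; apply/eqP; apply: eq_bigl => k.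
  case: ltnP; rewrite ?andbF // => ki; rewrite (ltn_trans ki lt) /= andbT.
  by symmetry; apply/eqP => e; rewrite e ltnn in ki.
- move=> x [i0 fi0]; pose i := [arg min_(i < i0 | 0 < f i x) (enum_rank i : nat)].
  exists i; rewrite /i; case: arg_minnP => // {}i fi min_i.
  apply: big1 => k ki; apply/eqP; rewrite eq_le f0 andbT leNgt.
  by apply/negP => /min_i; rewrite leqNgt ki.
Qed.

(* Cut a half-line from 0 into consecutive intervals of lengths f i x, and again
   into intervals of lengths g j x.  The overlaps of intervals of the two
   subdivisions form a staircase: a nondegenerate overlap is determined by its
   left endpoint, which is the left endpoint of an interval of one of the two
   subdivisions, and the common left endpoint 0 is shared. *)
Lemma has_cover_meet (P Q : set_system X) (n m : nat) : metrizable R X ->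
  (forall A B, A `<=` B -> P B -> P A) -> (forall A B, A `<=` B -> Q B -> Q A) ->
  has_cover P n -> has_cover Q m -> has_cover (P `&` Q) (n + m).
Proof.
move=> mX dP dQ [I [A [oA PA cA nA]]] [J [B [oB QB cB mB]]].
have /choice[f Hf] : forall i, exists f : X -> R,
    [/\ continuous f, forall x, 0 <= f x & forall x, (0 < f x) <-> A i x].
  by move=> i; exact: open_cozero.
have /choice[g Hg] : forall j, exists f : X -> R,
    [/\ continuous f, forall x, 0 <= f x & forall x, (0 < f x) <-> B j x].
  by move=> j; exact: open_cozero.
have cf i : continuous (f i) by case: (Hf i).
have cg j : continuous (g j) by case: (Hg j).
have f0 i x : 0 <= f i x by case: (Hf i).
have g0 j x : 0 <= g j x by case: (Hg j).
have fA i x : 0 < f i x <-> A i x by case: (Hf i).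
have gB j x : 0 < g j x <-> B j x by case: (Hg j).
have [s [cs s0 sD sP]] := partial_sums cf f0.
have [t [ct t0 tD tP]] := partial_sums cg g0.
(* The points where the two intervals overlap nondegenerately; strict inequalities between
   continuous functions make this set open. *)
pose W (p : I * J) := [set x | [/\ 0 < f p.1 x, 0 < g p.2 x,
  s p.1 x < t p.2 x + g p.2 x & t p.2 x < s p.1 x + f p.1 x]].
have olt (u v : X -> R) : continuous u -> continuous v -> open [set x | u x < v x].
  move=> cu cv; have -> : [set x | u x < v x] = (v - u) @^-1` [set r | 0 < r].
    by apply/seteqP; split=> x /=; rewrite subr_gt0.
  apply: open_comp; last exact: open_gt.
  by move=> x _; apply: continuousB; [exact: cv|exact: cu].
have cD (u v : X -> R) : continuous u -> continuous v -> continuous (u + v).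
  by move=> cu cv x; apply: continuousD; [exact: cu|exact: cv].
exists (I * J)%type, W; split.
- move=> [i j]; rewrite (_ : W (i, j) = [set x | 0 < f i x] `&` [set x | 0 < g j x] `&`
    ([set x | s i x < (t j + g j) x] `&` [set x | t j x < (s i + f i) x])).
    have c0 : continuous (fun _ : X => 0 : R) by move=> x; exact: cvg_cst.
    by apply: openI; apply: openI; apply: olt => //; exact: cD.
  apply/seteqP; split=> x /=; first by move=> [].
  by move=> [[]] ? ? [].
- move=> [i j]; split; [apply: dP (PA i)|apply: dQ (QB j)] => x [] /=.
    by move=> /fA.
  by move=> _ /gB.
- move=> x; have [i si fi] : exists2 i, s i x = 0 & 0 < f i x.
    by apply: sP; have [i /fA] := cA x; exists i.
  have [j tj gj] : exists2 j, t j x = 0 & 0 < g j x.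
    by apply: tP; have [j /gB] := cB x; exists j.
  by exists (i, j); split=> //=; rewrite ?si ?tj ?add0r.
- move=> x.
  have [j0 tj0 gj0] : exists2 j, t j x = 0 & 0 < g j x.
    by apply: tP; have [j /gB] := cB x; exists j.
  (* Records which interval starts at the left endpoint of the overlap. That endpoint lies in a
     single interval of the other subdivision, whence injectivity. *)
  pose psi (p : I * J) : I + J := if t p.2 x <= s p.1 x then inl p.1 else inr p.2.
  have psi_inj : {in [pred p | x \in W p] &, injective psi}.
    move=> [i j] [i' j']; rewrite !inE /psi /=.
    move=> -[/= fi gj sij tij] [/= fi' gj' sij' tij'].
    case: leP => ts; case: leP => ts' // [e]; subst; congr (_, _).
      apply/eqP/negPn/negP => /(tD _ _ x)[]; lra.
    apply/eqP/negPn/negP => /(sD _ _ x)[]; lra.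
  (* An [inr j] has [t j x > s i x >= 0], which excludes [j0]. This saves one: [n.+1 + m] is
     [(n + m).+1]. *)
  pose E := [pred u : I + J | match u with
    inl i => x \in A i | inr j => (x \in B j) && (j != j0) end].
  rewrite -(card_in_image psi_inj); apply: (@leq_trans #|E|).
    apply: subset_leq_card; apply/fintype.subsetP => u /fintype.imageP[[i j] + ->].
    rewrite inE; move=> -[/= /fA Ai /gB Bj sij tij].
    rewrite inE /psi /=; case: leP => ts; first by rewrite inE.
    apply/andP; split; first by rewrite inE.
    by apply/eqP => e; have := s0 i x; rewrite e tj0 in ts; lra.
  rewrite -sum1_card big_sumType /= !sum1_card.
  have hB : (#|[pred j | (x \in B j) && (j != j0)]| < m.+1)%N.
    apply: leq_trans (mB x); rewrite [leqRHS](cardD1 j0) inE.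
    have /gB Bj0 := gj0; rewrite mem_set // add1n ltnS.
    by apply: eq_leq; apply: eq_card => j; rewrite !inE andbC.
  rewrite -addSn; apply: leq_add; [exact: nA|exact: hB].
Qed.

End Staircase.

(** * Joins along a group action *)

(** The sets whose trace on every [e] in [E] lies in a member of [U^F], tested one [s] at a time.
    Taking [E] to be the fibres or the whole space alone gives the conditional or the absolute
    dimension. *)
Definition join_refiners (Gamma : groupType) (X : Type) (E : set_system X)
    (a : Gamma -> X -> X) (U : set_system X) (F : {fset Gamma}) : set_system X :=
  [set A | forall e s, E e -> s \in F ->
    exists2 B, U B & e `&` A `<=` a s @^-1` B].

Section JoinRefiners.
Variables (Gamma : groupType) (X : topologicalType) (a : Gamma -> X -> X).
Hypothesis act : continuous_action a.
Implicit Types (U E : set_system X) (F : {fset Gamma}).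

Lemma refines_fam_pow U F A :
  (exists2 B, fam_pow a U F B & A `<=` B) <->
  forall s, s \in F -> exists2 B, U B & A `<=` a s @^-1` B.
Proof.
have [a1 aM _] := act.
have transE s B : a s^-1%g @` B = a s @^-1` B.
  apply/seteqP; split=> [_ [x Bx <-]|x Bx] /=.
    by rewrite -aM mulgV a1.
  by exists (a s x) => //; rewrite -aM mulVg a1.
pose pow (r : seq Gamma) :=
  \big[@fam_join X/[set [set: X]]]_(s <- r) fam_translate a s^-1%g U.
suff H (r : seq Gamma) : (exists2 B, pow r B & A `<=` B) <->
    forall s, s \in r -> exists2 B, U B & A `<=` a s @^-1` B by exact: H.
rewrite /pow; elim: r => [|s r IH].
  by rewrite big_nil; split=> [_ s|_]; [rewrite in_nil|exists setT].
rewrite big_cons -/(pow r); split.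
  move=> [_ [_ [B UB <-] [C rC <-]]]; rewrite transE subsetI => -[AB AC] t.
  rewrite in_cons => /orP[/eqP ->|tr]; first by exists B.
  by apply: IH.1 tr; exists C.
move=> H; have [B UB AB] := H s (mem_head _ _).
have [C rC AC] : exists2 C, pow r C & A `<=` C.
  by apply/IH => t tr; apply: H; rewrite in_cons tr orbT.
exists (a s^-1%g @` B `&` C); last by rewrite transE subsetI.
by exists (a s^-1%g @` B); [exists B|exists C].
Qed.

Lemma refines_fam_join E U F W :
  refines (fam_join E W) (fam_pow a U F) <-> W `<=` join_refiners E a U F.
Proof.
split=> [H A WA e s Ee sF|H _ [e Ee [A WA <-]]].
  have /refines_fam_pow : exists2 B, fam_pow a U F B & e `&` A `<=` B.
    by apply: H; exists e => //; exists A.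
  exact.
by apply/refines_fam_pow => s sF; exact: H.
Qed.

Lemma cond_cover_dimE (Y : Type) (pi : X -> Y) U F :
  cond_cover_dim pi (fam_pow a U F) = min_ord (join_refiners (fibers pi) a U F).
Proof.
congr (nat_min (image _ _)); apply/seteqP.
by split=> W [oW /refines_fam_join].
Qed.

Lemma cover_dimE U F :
  cover_dim (fam_pow a U F) = min_ord (join_refiners [set setT] a U F).
Proof.
have H (W V : set_system X) : refines W V <-> refines (fam_join [set setT] W) V.
  split=> h A.
    by move=> [_ -> [B WB <-]]; rewrite setTI; exact: h.
  by move=> WA; apply: h; exists setT => //; exists A; rewrite ?setTI.
congr (nat_min (image _ _)); apply/seteqP.
split=> W [oW].
  by move=> /H/refines_fam_join.
by move=> /refines_fam_join h; split=> //; apply/H.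
Qed.

Lemma join_refinersS E U F A B : A `<=` B ->
  join_refiners E a U F B -> join_refiners E a U F A.
Proof.
move=> AB H e s Ee sF; have [C UC BC] := H e s Ee sF.
by exists C => // x [ex /AB Bx]; exact: BC.
Qed.

Lemma join_refinersU E U F1 F2 :
  join_refiners E a U F1 `&` join_refiners E a U F2 `<=`
  join_refiners E a U (F1 `|` F2)%fset.
Proof.
by move=> A [H1 H2] e s Ee; rewrite in_fsetU => /orP[]; [exact: H1|exact: H2].
Qed.

Variable R : realType.
Hypothesis metrizableX : metrizable R X.

Lemma has_cover_join_refinersU E U F1 F2 n1 n2 :
  has_cover (join_refiners E a U F1) n1 -> has_cover (join_refiners E a U F2) n2 ->
  has_cover (join_refiners E a U (F1 `|` F2)%fset) (n1 + n2).
Proof.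
move=> h1 h2; apply: has_cover_sub (@join_refinersU E U F1 F2) _.
by apply: (has_cover_meet metrizableX) => // A B; exact: join_refinersS.
Qed.

(** Join the preimages of [U] one group element at a time. Existence matters because [min_ord] is
    the default 0 when there is no admissible cover. *)
Lemma has_cover_join_refiners E U F : finite_open_cover U ->
  exists n, has_cover (join_refiners E a U F) n.
Proof.
move=> oU; elim/finSet_rect: F => F IH.
have [->|/fset0Pn[s sF]] := eqVneq F fset0.
  by exists 0%N; apply: has_coverT => e s _; rewrite in_fset0.
have [n hn] := IH _ (fproperD1 sF).
exists (ord U + n)%N; rewrite -(fsetD1K sF); apply: has_cover_join_refinersU hn.
have [_ _ ca] := act.
apply: (has_cover_preimage (Q := U) (ca s)).
  move=> B UB e t _; rewrite in_fset1 => /eqP ->.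
  by exists B => // x [].
by apply/has_cover_ord; exists U; split.
Qed.

Lemma min_ord_join_refiners_ge (X' : topologicalType) (P : set_system X') E U F :
  finite_open_cover U ->
  (forall n, has_cover (join_refiners E a U F) n -> has_cover P n) ->
  (min_ord P <= min_ord (join_refiners E a U F))%N.
Proof.
move=> oU H; have [n /has_cover_min_ord[hm _]] := has_cover_join_refiners E F oU.
by apply: min_ord_le; exact: H.
Qed.

(** Subadditivity comes from the staircase. For translates, pull covers back by [a t]: since [a t]
    maps each [e] into a member of [E], refiners for [F] become refiners for [rtranslate F t]. *)
Lemma cvg_min_ord_join_refiners E U : amenable R Gamma -> finite_open_cover U ->
  (forall t e, E e -> exists2 e', E e' & e `<=` a t @^-1` e') ->
  cvg (((min_ord (join_refiners E a U F))%:R / #|` F|%:R : R) @[F --> folner R Gamma]).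
Proof.
move=> amen oU invE.
have [_ aM ca] := act.
apply: (@ornstein_weiss R Gamma (fun F => (min_ord (join_refiners E a U F))%:R)) => //.
- apply/eqP; rewrite pnatr_eq0 -leqn0; apply: min_ord_le; apply: has_coverT.
  by move=> e s _; rewrite in_fset0.
- move=> F1 F2; rewrite -natrD ler_nat.
  have [n1 /has_cover_min_ord[h1 _]] := has_cover_join_refiners E F1 oU.
  have [n2 /has_cover_min_ord[h2 _]] := has_cover_join_refiners E F2 oU.
  by apply: min_ord_le; exact: has_cover_join_refinersU.
- move=> F t; rewrite ler_nat; apply: min_ord_join_refiners_ge => // n.
  apply: has_cover_preimage (ca t) _ => A HA e _ Ee /rtranslateP[s sF ->].
  have [e' Ee' ee'] := invE t e Ee; have [B UB AB] := HA e' s Ee' sF.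
  exists B => // x [/ee' ex Ax] /=; rewrite aM.
  exact: AB.
Qed.

End JoinRefiners.

(** * Product covers and comparison of the limits *)

(** A tube argument: compactness of [Y] gives each [z] a neighbourhood serving all slices, with a
    member of [V] depending on [y]; compactness of [Z] leaves finitely many neighbourhoods. *)
Lemma product_cover_refinement (R : realType) (Y Z : topologicalType)
    (V : set_system (Y * Z)) : metrizable R Z ->
  compact [set: Y] -> compact [set: Z] -> finite_open_cover V ->
  exists2 U, finite_open_cover U & forall y B, U B ->
    exists2 A, V A & forall z, B z -> A (y, z).
Proof.
move=> [d [d0 _ dC dT dN]] cY cZ [_ oV cV].
have /choice[W HW] : forall z : Z, exists W : set Z, [/\ open W, W z &
    forall y, exists2 A, V A & forall z, W z -> A (y, z)].
  move=> z.
  have /compact_near_coveringP nc := cY.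
  pose P (e : R) (y : Y) := exists2 A, V A & forall z', d z z' < e -> A (y, z').
  (* Near-covering along the filter of small positive radii makes one radius serve all [y]. *)
  have : \forall e \near (0 : R)^'+, [set: Y] `<=` P e.
    apply: nc => y _.
    have [A VA Ayz] : (\bigcup_(A in V) A) (y, z) by rewrite cV.
    have /open_nbhs_nbhs [[B C] /= [By /dN[e e0 Ce]] BCA] : open_nbhs (y, z) A.
      by split=> //; exact: oV.
    exists (B, [set r | r < e]) => /=.
      by split=> //; exact: nbhs_right_lt.
    move=> [y' r] /= [By' re]; exists A => // z' zz'; apply: BCA; split => //=.
    by apply: Ce; apply: lt_trans re.
  move=> nearP; have [e e0 He] : exists2 e : R, 0 < e & [set: Y] `<=` P e.
    near (0 : R)^'+ => e; exists e; first by near: e; exact: nbhs_right_gt.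
    by near: e.
  exists [set z' | d z z' < e]^°; split; first exact: open_interior.
    by apply/dN; exists e.
  move=> y; have [A VA HA] := He y I; exists A => // z' /interior_subset; exact: HA.
have [D DW] : exists D : {fset Z}, forall z, exists2 z0, z0 \in D & W z0 z.
  (* Near-covering along finite sets of centres ordered by inclusion yields a finite subcover. *)
  pose G : set_system {fset Z} := filter_from setT (fun D0 => [set D | (D0 `<=` D)%fset]).
  have FG : Filter G.
    apply: filter_from_filter; first by exists fset0.
    move=> D1 D2 _ _; exists (D1 `|` D2)%fset => // D /=.
    by rewrite fsubUset => /andP.
  have /compact_near_coveringP
    /(_ _ G (fun D z => exists2 z0, z0 \in D & W z0 z) FG) := cZ.
  case=> [z _|D _ HD]; last by exists D => z; exact: (HD D (fsubset_refl D) z).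
  have [oW Wz _] := HW z.
  exists (W z, [set D | ([fset z] `<=` D)%fset]) => /=.
    by split; [exact: open_nbhs_nbhs|exists [fset z]%fset].
  by move=> [z' D] /= [Wz' zD]; exists z => //; rewrite -fsub1set.
exists (W @` [set` D]).
  split; first exact: finite_image.
    by move=> _ [z _ <-]; case: (HW z).
  apply/seteqP; split=> // z _; have [z0 Dz0 Wz] := DW z.
  by exists (W z0) => //; exists z0.
by move=> y _ [z _ <-]; case: (HW z) => _ _; exact.
Unshelve. all: by end_near. Qed.

Lemma le_folner_lim (R : realType) (Gamma : groupType) (f g : {fset Gamma} -> R) :
  amenable R Gamma -> cvg (f F @[F --> folner R Gamma]) ->
  cvg (g F @[F --> folner R Gamma]) -> (forall F, f F <= g F) ->
  folner_lim f <= folner_lim g.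
Proof.
move=> amen cf cg fg; have FF := folner_proper amen.
rewrite -subr_ge0; apply: (cvgr_to_ge (cvgB cg cf)).
by apply: nearW => F /=; rewrite subr_ge0.
Qed.

Theorem proposition2p4 (R : realType) (Gamma : groupType)
    (Gamma_countable : countable [set: Gamma])
    (Gamma_amenable : amenable R Gamma)
    (Y Z : topologicalType) (aY : Gamma -> Y -> Y) (aZ : Gamma -> Z -> Z)
    (hY : dynamical_system R aY) (hZ : dynamical_system R aZ) :
  cond_mdim R (diagonal_action aY aZ) (fst : Y * Z -> Y) = mdim R aZ.
Proof.
have [[y0 _] cY mY actY] := hY; have [[z0 _] cZ mZ actZ] := hZ.
have [_ _ mYZ actYZ] := diagonal_system hY hZ.
pose aYZ := diagonal_action aY aZ.
pose phi U F : R := (cover_dim (fam_pow aZ U F))%:R / #|` F|%:R.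
pose psi V F : R :=
  (cond_cover_dim (fst : Y * Z -> Y) (fam_pow aYZ V F))%:R / #|` F|%:R.
have cvgZ U : finite_open_cover U -> cvg (phi U F @[F --> folner R Gamma]).
  move=> oU.
  have invT t e : [set [set: Z]] e ->
      exists2 e', [set [set: Z]] e' & e `<=` aZ t @^-1` e'.
    by move=> ->; exists setT.
  suff -> : phi U = fun F =>
      (min_ord (join_refiners [set setT] aZ U F))%:R / #|` F|%:R.
    exact: (cvg_min_ord_join_refiners actZ mZ Gamma_amenable oU invT).
  by apply/funext => F; rewrite /phi (cover_dimE actZ).
have cvgYZ V : finite_open_cover V -> cvg (psi V F @[F --> folner R Gamma]).
  move=> oV.
  have invY t e : fibers (fst : Y * Z -> Y) e ->
      exists2 e', fibers (fst : Y * Z -> Y) e' & e `<=` aYZ t @^-1` e'.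
    move=> [y _ <-]; exists (fst @^-1` [set aY t y]); first by exists (aY t y).
    by move=> p /= ->.
  suff -> : psi V = fun F =>
      (min_ord (join_refiners (fibers fst) aYZ V F))%:R / #|` F|%:R.
    exact: (cvg_min_ord_join_refiners actYZ mYZ Gamma_amenable oV invY).
  by apply/funext => F; rewrite /psi (cond_cover_dimE actYZ).
rewrite /cond_mdim /mdim; apply/le_anti/andP; split.
- apply: ub_ereal_sup => _ [V oV <-].
  have [U oU UV] := product_cover_refinement mZ cY cZ oV.
  apply: (@le_trans _ _ (folner_lim (phi U))%:E); last first.
    by apply: ereal_sup_ubound; exists U.
  rewrite lee_fin; apply: le_folner_lim => //; [exact: cvgYZ|exact: cvgZ|move=> F].
  rewrite ler_wpM2r // ler_nat (cover_dimE actZ) (cond_cover_dimE actYZ).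
  apply: (min_ord_join_refiners_ge actZ mZ) => // n.
  apply: has_cover_preimage => [p|A HA _ s [y _ <-] sF]; first exact: cvg_snd.
  (* The action moves the fibre over [y] to that over [aY s y], so [B] is compared with [V] on the
     latter slice. *)
  have [B UB AB] := HA setT s erefl sF; have [C VC BC] := UV (aY s y) B UB.
  exists C => // -[y' z] /= [-> Az]; apply: BC; exact: AB.
- apply: ub_ereal_sup => _ [U oU <-].
  pose V : set_system (Y * Z) := [set snd @^-1` B | B in U].
  have oV : finite_open_cover V.
    have [finU openU covU] := oU; split; first exact: finite_image.
      by move=> _ [B /openU oB <-]; apply: open_comp => // p _; exact: cvg_snd.
    apply/seteqP; split=> // p _.
    have [B UB Bp] : (\bigcup_(B in U) B) p.2 by rewrite covU.
    by exists (snd @^-1` B) => //; exists B.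
  apply: (@le_trans _ _ (folner_lim (psi V))%:E); last first.
    by apply: ereal_sup_ubound; exists V.
  rewrite lee_fin; apply: le_folner_lim => //; [exact: cvgZ|exact: cvgYZ|move=> F].
  rewrite ler_wpM2r // ler_nat (cover_dimE actZ) (cond_cover_dimE actYZ).
  apply: (min_ord_join_refiners_ge actYZ mYZ) => // n.
  (* Covers restrict to the slice over [y0]. This slice need not be invariant, but members of [V]
     are preimages under [snd], which is equivariant. *)
  apply: (has_cover_preimage (f := fun z => (y0, z))).
    by move=> z; apply: cvg_pair; [exact: cvg_cst|exact: cvg_id].
  move=> A HA _ s -> sF.
  have [_ [B UB <-] AB] := HA (fst @^-1` [set y0]) s (ex_intro2 _ _ y0 I erefl) sF.
  by exists B => // z [_ Az]; exact: (AB (y0, z)).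
Qed.
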